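(* Let $n\ge 0$ be an integer, let $0\le k_0<k_1<\dots<k_n$ be integers, and let $P(z)=\sum_{\nu=0}^{n}a_\nu z^{k_\nu}$ be an algebraic polynomial of degree $k_n$ with coefficients $a_0,\dots,a_n\in\mathbb C\setminus\{0\}$. If $$\min_{t\in\overline{\mathbb D}}\operatorname{Re}\sum_{j=0}^{n-\nu}\frac{a_{j+\nu}}{a_\nu}\,t^{k_{j+\nu}-k_\nu}\ge\frac12,\qquad \nu=0,1,\dots,n,$$ then the following assertions hold. (i) The polynomial $P$ has no zeros in $\overline{\mathbb D}$ if $k_0=0$, and has no zeros in $\overline{\mathbb D}\setminus\{0\}$ if $k_0>0$. (ii) For all $z\in\overline{\mathbb D}$, $$|zP'(z)|\le k_n|P(z)|.$$ If $z\in\mathbb D$, equality occurs here only in the case $n=0$, that is, for $P(z)=a_0z^{k_0}$, $k_0>0$. (iii) If $k_0=0$ and $n\ge1$, then $$|P'(z)|<k_n|P(z)|$$ for all $z\in\mathbb D$.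
   Context: $\mathbb D=\{z\in\mathbb C:|z|<1\}$ is the open unit disc and $\overline{\mathbb D}=\{z\in\mathbb C:|z|\le1\}$ is the closed unit disc.
   Formalization: In (ii), equality at z in the open disc also occurs trivially (0=0) when z=0 and k_0>0 (e.g. P=z+z^2/2) or when n=0 and k_0=0; these cases are added as alternatives, and equality is shown to hold exactly in the stated case or in one of these. *)

(* Defs.v *)
From mathcomp Require Export all_boot all_order all_algebra.
From mathcomp Require Export reals.
From mathcomp.real_closed Require Export complex.

Set Implicit Arguments.
Unset Strict Implicit.
Unset Printing Implicit Defensive.

Import GRing.Theory.
Local Open Scope ring_scope.

Section Lacunary.
Variables (R : realType) (n : nat) (a : nat -> R[i]) (k : nat -> nat).

(* Only the values a 0, ..., a n and k 0, ..., k n are used. *)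
Definition lacunary_poly : {poly R[i]} :=
  \sum_(0 <= nu < n.+1) a nu *: 'X^(k nu).

(* For nu <= n and increasing k, the tail \sum_(nu <= m <= n) a m * t ^+ k m
   of the polynomial divided by its leading term at 0, a nu * t ^+ k nu. The
   truncated subtractions are exact in that range. *)
Definition tail_quotient (nu : nat) (t : R[i]) : R[i] :=
  \sum_(0 <= j < (n - nu).+1)
     a (j + nu)%N / a nu * t ^+ (k (j + nu)%N - k nu).

End Lacunary.

(* Main.v *)
Require Import Defs.
From mathcomp Require Import all_boot all_order all_algebra.
From mathcomp Require Import reals cyclic separable cyclotomic.
From mathcomp.real_closed Require Import complex.
From mathcomp Require Import zify ring lra.

Set Implicit Arguments.
Unset Strict Implicit.
Unset Printing Implicit Defensive.

Import Order.TTheory GRing.Theory Num.Theory.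
Local Open Scope ring_scope.

(** Let [S_nu] be the tail of [P] starting at the term [a_nu z^(k_nu)], so that
    the [nu]-th hypothesis reads [Re (S_nu / (a_nu z^(k_nu))) >= 1/2]. Since
    [Re q >= 1/2] means [|q - 1| <= |q|], it gives [|S_(nu+1)| <= |S_nu|] on the
    closed disc. Abel summation writes [z P'] as
    [k_0 S_0 + sum_i (k_(i+1) - k_i) S_(i+1)], and the bound [k_n |P|] follows by
    telescoping. Strictness comes from the last step alone: the binomial
    [1 + c t^d] has real part at least [1/2] on the disc only if [|c| <= 1/2].
    For the bound on [P'] itself, the Schwarz lemma improves [|S_1| <= |S_0|] to
    [|S_1| <= |z| |S_0|]. For polynomials it can be proved by averaging over
    roots of unity: with nonnegative weights [2 Re T - 1], the value [T(z)] is a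
    limit of averages of points of a disc depending only on [|z|]. *)

(** * Roots of unity as averaging nodes *)

Section ClosedField.
Variable C : numClosedFieldType.
Implicit Types (z v q c : C) (T : {poly C}).

(** ['X^n - 1] splits and is separable, so it has [n] distinct roots; among [n] distinct [n]-th
    roots of unity one is primitive. *)
Lemma prim_root_exists (n : nat) :
  (0 < n)%N -> exists v : C, n.-primitive_root v.
Proof.
move=> n_gt0; pose p : {poly C} := 'X^n - 1.
have [r] := closed_field_poly_normal p.
rewrite (monicP (monicXnsubC _ n_gt0)) scale1r => Dp.
have r_unity : all n.-unity_root r.
  by apply/allP => v; rewrite -root_prod_XsubC -Dp.
have r_uniq : uniq r.
  by rewrite -separable_prod_XsubC -Dp separable_Xn_sub_1 // pnatr_eq0 -lt0n.
have r_size : (n <= size r)%N.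
  by rewrite -ltnS -(size_prod_XsubC r id) -Dp size_XnsubC.
by have /hasP[v _ v_prim] := has_prim_root n_gt0 r_unity r_uniq r_size; exists v.
Qed.

Lemma norm_prim_root n v : n.-primitive_root v -> `|v| = 1.
Proof.
move=> vP; apply/eqP; rewrite -(@pexpr_eq1 _ _ n) ?(prim_order_gt0 vP) //.
by rewrite -normrX (prim_expr_order vP) normr1.
Qed.

Lemma sum_prim_root_expr n v s : n.-primitive_root v ->
  \sum_(i < n) (v ^+ i) ^+ s = if (n %| s)%N then n%:R else 0.
Proof.
move=> vP; under eq_bigr do rewrite exprAC.
rewrite (prim_order_dvd vP); have [->|v_neq1] := eqVneq.
  by under eq_bigr do rewrite expr1n; rewrite sumr_const card_ord.
(* Multiplied by [v ^+ s - 1], the geometric sum collapses to v^(ns) - 1 = 0. *)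
apply: (mulfI (x := v ^+ s - 1)); first by rewrite subr_eq0.
by rewrite -subrX1 exprAC (prim_expr_order vP) expr1n subrr mulr0.
Qed.

Lemma double_Re q : 2 * 'Re q = q + q^*.
Proof. by rewrite ReE mulrC divfK ?pnatr_eq0. Qed.

(* With the points conjugated, [T] contributes the frequencies [m - j] and
   [T^*] the frequencies [m + j]; the bound on [N] prevents aliasing. *)
Lemma Re_moment N v T m : N.-primitive_root v -> (m + size T <= N)%N ->
  T`_0 = 1 ->
  \sum_(i < N) (2 * 'Re T.[(v ^+ i)^*] - 1) * (v ^+ i) ^+ m = N%:R * T`_m.
Proof.
move=> vP mTN T0.
have T_gt0 : (0 < size T)%N.
  rewrite lt0n size_poly_eq0; apply: contra_eq_neq T0 => ->.
  by rewrite coef0 eq_sym oner_eq0.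
have mN : (m < N)%N by rewrite (leq_trans _ mTN) // -addn1 leq_add2l.
have TN : (size T <= N)%N by rewrite (leq_trans _ mTN) // leq_addl.
have vN i : (v ^+ i) ^+ N = 1 by rewrite exprAC (prim_expr_order vP) expr1n.
have vV i : v ^+ i * (v ^+ i)^* = 1.
  by rewrite -normCK normrX (norm_prim_root vP) !expr1n.
(* Conjugation inverts on the unit circle; exponents modulo [N] keep the frequencies natural
   numbers. *)
have conjvE i (j : 'I_N) : (v ^+ i)^* ^+ j = (v ^+ i) ^+ (N - j).
  have v_neq0 : (v ^+ i) ^+ j != 0.
    by rewrite -normr_eq0 !normrX (norm_prim_root vP) !expr1n oner_eq0.
  apply: (mulfI v_neq0); rewrite -exprMn vV expr1n -exprD subnKC ?vN //.
  exact: ltnW.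
have -> : \sum_(i < N) (2 * 'Re T.[(v ^+ i)^*] - 1) * (v ^+ i) ^+ m =
    \sum_(j < N) T`_j * (\sum_(i < N) (v ^+ i) ^+ (N - j + m)) +
    \sum_(j < N) (T`_j)^* * (\sum_(i < N) (v ^+ i) ^+ (j + m)) -
    \sum_(i < N) (v ^+ i) ^+ m.
  under [X in X + _ - _]eq_bigr do rewrite mulr_sumr.
  under [X in _ + X - _]eq_bigr do rewrite mulr_sumr.
  rewrite exchange_big [X in _ + X - _]exchange_big -big_split -sumrB /=.
  apply: eq_bigr => i _; rewrite double_Re mulrBl mul1r mulrDl.
  rewrite (horner_coef_wide _ TN) rmorph_sum !mulr_suml; congr (_ + _ - _).
    by apply: eq_bigr => j _; rewrite exprD conjvE mulrA.
  by apply: eq_bigr => j _; rewrite exprD rmorphM rmorphXn /= conjCK mulrA.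
(* Only j = m survives: N - j + m lies strictly between 0 and N if j > m, and strictly between N and
   2N if j < m. *)
rewrite (bigD1 (Ordinal mN)) //= sum_prim_root_expr // subnK ?(ltnW mN) // dvdnn.
rewrite big1 ?addr0 => [|j j_neq]; last first.
  rewrite sum_prim_root_expr //; case: ifP; rewrite ?mulr0 // => /dvdnP[t].
  case: (ltngtP j m) j_neq => [jm|mj|jm]; last first.
  - by rewrite -val_eqE /= jm eqxx.
  - move=> _ E; suff : (0 < t < 1)%N by case: t {E} => [|[]].
    have /andP[] : (0 < t * N < 1 * N)%N.
      by rewrite -E; move: (ltn_ord j) mj mN; clear; lia.
    by rewrite muln_gt0 => /andP[-> _]; rewrite ltn_mul2r => /andP[_ ->].
  move=> _ E; suff : (1 < t < 2)%N by case: t {E} => [|[]].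
  have : (1 * N < t * N < 2 * N)%N.
    by rewrite -E; move: (ltn_ord j) jm mN; clear; lia.
  by rewrite !ltn_mul2r => /andP[/andP[_ ->] /andP[_ ->]].
(* In the conjugate part only j = 0 survives, and it cancels the contribution of the -1 in the
   weights. *)
rewrite [X in _ + X - _](_ : _ = \sum_(i < N) (v ^+ i) ^+ m) ?addrK 1?mulrC //.
rewrite (bigD1 (Ordinal (prim_order_gt0 vP))) //= T0 rmorph1 mul1r add0n.
rewrite [X in _ + X]big1 ?addr0 // => j j_neq0.
have [jT|Tj] := ltnP j (size T); last by rewrite nth_default // rmorph0 mul0r.
rewrite sum_prim_root_expr // gtnNdvd ?mulr0 //.
  rewrite addn_gt0 lt0n.
  by rewrite -[j == 0 :> nat]/(j == Ordinal (prim_order_gt0 vP)) j_neq0.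
by rewrite (leq_trans _ mTN) // addnC ltn_add2l.
Qed.

(** * Discrete Schwarz lemma and coefficient bound *)

(* The geometric sum is close to 1/(1 - z), which lies on the boundary circle
   of the disc |(1 - |z|^2) q - 1| <= |z|. *)
Lemma geometric_sum_disc z L : `|z| < 1 ->
  `|(1 - `|z| ^+ 2) * (\sum_(m < L) z ^+ m) - 1| <= `|z| + 2 * `|z| ^+ L.
Proof.
move=> z_lt1; have z1 : 0 < `|1 - z|.
  rewrite normr_gt0 subr_eq0; apply: contraTneq z_lt1 => <-.
  by rewrite normr1 ltxx.
have geom : (1 - z) * (\sum_(m < L) z ^+ m) = 1 - z ^+ L.
  by rewrite -opprB mulNr -subrX1 opprB.
rewrite -(ler_pM2l z1) -normrM mulrBr mulr1 mulrCA geom.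
(* The main term has modulus exactly |z| |1 - z|; the error is controlled by 1 - |z| <= |1 - z| and
   1 + |z| <= 2. *)
have -> : (1 - `|z| ^+ 2) * (1 - z ^+ L) - (1 - z) =
          z * (1 - z)^* - (1 - `|z| ^+ 2) * z ^+ L.
  by rewrite rmorphB rmorph1 normCK; ring.
apply: le_trans (ler_normB _ _) _.
rewrite !normrM norm_conjC normrX mulrDr mulrC lerD2l mulrA.
apply: ler_wpM2r; first exact: exprn_ge0.
have r2 : 0 <= 1 - `|z| ^+ 2 by rewrite subr_ge0 exprn_ile1 // ltW.
have -> : `|1 - `|z| ^+ 2| = (1 - `|z|) * (1 + `|z|).
  by rewrite ger0_norm //; ring.
apply: ler_pM; rewrite ?subr_ge0 ?addr_ge0 ?(ltW z_lt1) //.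
  by rewrite -[X in X - _]normr1 lerB_dist.
by rewrite (_ : 2 = 1 + 1 :> C) // lerD2l ltW.
Qed.

(** By [Re_moment], T(z) is the average of the geometric sums at the points z v^i with nonnegative
    weights of mean 1. Each sum satisfies [geometric_sum_disc], and discs are convex. *)
Lemma Schwarz_disc_approx T z L : T`_0 = 1 ->
  (forall t, `|t| <= 1 -> 2^-1 <= 'Re T.[t]) ->
  `|z| < 1 -> (size T <= L)%N ->
  `|(1 - `|z| ^+ 2) * T.[z] - 1| <= `|z| + 2 * `|z| ^+ L.
Proof.
move=> T0 T_ge z_lt1 TL.
have L_gt0 : (0 < L)%N.
  apply: leq_trans TL; rewrite lt0n size_poly_eq0.
  by apply: contra_eq_neq T0 => ->; rewrite coef0 eq_sym oner_eq0.
(* Twice [L] nodes rule out aliasing for every moment m < L, as [size T <= L]. *)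
pose N := (L + L)%N; have N_gt0 : (0 < N)%N by rewrite addn_gt0 L_gt0.
have NC_gt0 : 0 < N%:R :> C by rewrite ltr0n.
have [v vP] := prim_root_exists N_gt0.
pose h i := 2 * 'Re T.[(v ^+ i)^*] - 1.
have v1 i : `|v ^+ i| = 1 by rewrite normrX (norm_prim_root vP) expr1n.
have h_ge0 i : 0 <= h i.
  have := T_ge (v ^+ i)^*; rewrite norm_conjC v1 => /(_ (lexx _)).
  by rewrite subr_ge0 -(ler_pM2l (_ : 0 < 2)) ?mulfV ?pnatr_eq0.
have mean1 : \sum_(i < N) h i = N%:R.
  have TN : (0 + size T <= N)%N by rewrite leq_add.
  rewrite -[RHS]mulr1 -[X in _ * X]T0 -(Re_moment vP TN T0).
  by apply: eq_bigr => i _; rewrite expr0 mulr1.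
have meanT : \sum_(i < N) h i * (\sum_(m < L) (z * v ^+ i) ^+ m) = N%:R * T.[z].
  rewrite (horner_coef_wide _ TL) mulr_sumr.
  under eq_bigr do rewrite mulr_sumr.
  rewrite exchange_big; apply: eq_bigr => m _ /=.
  rewrite mulrA -(Re_moment vP) //; last by rewrite leq_add // ltnW.
  by rewrite mulr_suml; apply: eq_bigr => i _; rewrite exprMn mulrCA mulrC.
rewrite -(ler_pM2l NC_gt0) -[X in X * `|_|]normr_nat -normrM mulrBr mulr1 mulrCA.
rewrite -meanT -[X in _ - X]mean1 mulr_sumr -sumrB -[X in X * _]mean1 mulr_suml.
apply: le_trans (ler_norm_sum _ _ _) _; apply: ler_sum => i _.
have zv : `|z * v ^+ i| = `|z| by rewrite normrM v1 mulr1.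
rewrite mulrCA -[X in _ - X]mulr1 -mulrBr normrM ger0_norm //.
by apply: ler_wpM2l => //; rewrite -zv; apply: geometric_sum_disc; rewrite zv.
Qed.

Lemma norm_coef1_le T : T`_0 = 1 ->
  (forall t, `|t| <= 1 -> 2^-1 <= 'Re T.[t]) -> `|T`_1| <= 1.
Proof.
move=> T0 T_ge; pose N := (1 + size T)%N.
have NC_gt0 : 0 < N%:R :> C by rewrite ltr0n.
have [v vP] := @prim_root_exists N isT.
have v1 i : `|v ^+ i| = 1 by rewrite normrX (norm_prim_root vP) expr1n.
rewrite -(ler_pM2l NC_gt0) -[X in X * `|_|]normr_nat -normrM mulr1.
have TN : (0 + size T <= N)%N by rewrite leq_add.
rewrite -(Re_moment vP) // -[leRHS]mulr1 -[X in _ <= _ * X]T0 -(Re_moment vP TN T0).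
apply: le_trans (ler_norm_sum _ _ _) _; apply: ler_sum => i _.
rewrite normrM expr1 v1 expr0 ger0_norm //.
have := T_ge (v ^+ i)^*; rewrite norm_conjC v1 => /(_ (lexx _)).
by rewrite subr_ge0 -(ler_pM2l (_ : 0 < 2)) ?mulfV ?pnatr_eq0.
Qed.

(** * Half-planes, discs and binomials *)

Lemma norm_sub1_le q : 2^-1 <= 'Re q -> `|q - 1| <= `|q|.
Proof.
move=> q_ge; rewrite -ler_sqr ?nnegrE // !normCK rmorphB rmorph1 -subr_ge0.
have -> : q * q^* - (q - 1) * (q^* - 1) = 2 * 'Re q - 1.
  by rewrite double_Re; ring.
by rewrite subr_ge0 -(ler_pM2l (_ : 0 < 2)) ?mulfV ?pnatr_eq0 in q_ge *.
Qed.

(** Both conditions describe the same Apollonius disc: r^2 - |(1 - r^2) q - 1|^2 = (1 - r^2) (r^2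
    |q|^2 - |q - 1|^2). *)
Lemma norm_sub1_le_scale r q : 0 <= r < 1 ->
  `|(1 - r ^+ 2) * q - 1| <= r -> `|q - 1| <= r * `|q|.
Proof.
move=> /andP[r_ge0 r_lt1]; have r_real : r^* = r by apply/CrealP/ger0_real.
have r2 : 0 < 1 - r ^+ 2 by rewrite subr_gt0 exprn_ilt1.
rewrite -ler_sqr ?nnegrE // -[X in _ -> is_true X]ler_sqr ?nnegrE ?mulr_ge0 //.
rewrite exprMn !normCK -subr_ge0 -[X in _ -> is_true X]subr_ge0.
rewrite !rmorphB !rmorph1 rmorphM rmorphB rmorph1 rmorphXn /= r_real.
rewrite -[X in _ -> is_true X](pmulr_rge0 _ r2).
by move=> /le_trans; apply; rewrite le_eqVlt; apply/orP/or_introl/eqP; ring.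
Qed.

Lemma norm_binomial_coef_le c d : (0 < d)%N ->
  (forall t, `|t| <= 1 -> 2^-1 <= 'Re (1 + c * t ^+ d)) -> `|c| <= 2^-1.
Proof.
move=> d_gt0 H; have [->|c_neq0] := eqVneq c 0; first by rewrite normr0 invr_ge0.
(* [c t^d] is as negative as possible on the closed disc. *)
pose t := d.-root (- (`|c| / c)).
have td : t ^+ d = - (`|c| / c) by rewrite rootCK.
have t1 : `|t| = 1.
  apply/eqP; rewrite -(@pexpr_eq1 _ _ d) // -normrX td normrN normrM normfV.
  by rewrite normr_id mulfV ?normr_eq0.
have := H t; rewrite t1 td mulrN mulrCA mulfV // mulr1 => /(_ (lexx _)).
rewrite (Creal_ReP _ _) ?realB ?normr_real ?real1 // lerBrDr -lerBrDl.
by rewrite [X in X - _](splitr 1) mul1r addrK.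
Qed.

(** The value |z|/2 separates the two sides: |c z^d| <= |z|/2 < 1/2, hence |1 + c z^d| > 1/2. *)
Lemma norm_binomial_lt c d z : (0 < d)%N -> `|c| <= 2^-1 -> 0 < `|z| < 1 ->
  `|c * z ^+ d| < `|z| * `|1 + c * z ^+ d|.
Proof.
move=> d_gt0 c_le /andP[z_gt0 z_lt1].
have le_cz : `|c * z ^+ d| <= `|z| / 2.
  rewrite normrM normrX mulrC ler_pM // ?exprn_ge0 //.
  by rewrite -[leRHS]expr1 ler_wiXn2l // ltW.
apply: le_lt_trans (le_cz) _; rewrite ltr_pM2l //.
have half1 : 2^-1 = 1 - 2^-1 :> C by rewrite [X in X - _](splitr 1) mul1r addrK.
apply: lt_le_trans (_ : 1 - `|c * z ^+ d| <= _).
  rewrite [X in X < _]half1 ltrD2l ltrN2; apply: le_lt_trans (le_cz) _.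
  by rewrite -[ltRHS]mul1r ltr_pM2r ?invr_gt0.
by rewrite -[X in X - _]normr1 lerB_normD.
Qed.

(** * Abel summation and telescoping bounds *)

Lemma abel_summation (c b : nat -> C) n :
  \sum_(m < n.+1) c m * b m =
  c 0%N * \sum_(0 <= m < n.+1) b m +
  \sum_(i < n) (c i.+1 - c i) * \sum_(i.+1 <= m < n.+1) b m.
Proof.
have telescope n' : \sum_(i < n') (c i.+1 - c i) = c n' - c 0%N.
  by rewrite -(big_mkord xpredT (fun i => c i.+1 - c i)) telescope_sumr.
elim: n => [|n IH]; first by rewrite big_ord1 big_ord0 big_nat1 addr0.
rewrite big_ord_recr IH big_ord_recr [in RHS]big_nat_recr //= big_nat1 /=.
(* Every tail gains the same term [b n.+1], whose coefficients telescope to [c n.+1]. *)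
under [X in _ = _ + (X + _)]eq_bigr => i _ do
  rewrite big_nat_recr ?mulrDr /= 1?ltnS 1?ltnW 1?ltn_ord //.
by rewrite big_split -mulr_suml telescope /=; ring.
Qed.

End ClosedField.

Lemma norm_abel_le (F : numDomainType) (k : nat -> nat) (s : nat -> F) n B :
  (forall i, (i < n)%N -> (k i <= k i.+1)%N) ->
  (forall i, (i < n)%N -> `|s i.+1| <= B) ->
  `|\sum_(i < n) ((k i.+1)%:R - (k i)%:R) * s i.+1|
    <= ((k n)%:R - (k 0%N)%:R) * B.
Proof.
elim: n => [|n IH] k_le s_le; first by rewrite big_ord0 normr0 subrr mul0r.
have -> : (k n.+1)%:R - (k 0%N)%:R =
    ((k n)%:R - (k 0%N)%:R) + ((k n.+1)%:R - (k n)%:R) :> F by ring.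
rewrite [leRHS]mulrDl big_ord_recr /=.
apply: le_trans (ler_normD _ _) _; apply: lerD.
  by apply: IH => i /ltnW; [exact: k_le | exact: s_le].
rewrite normrM ger0_norm ?subr_ge0 ?ler_nat ?k_le //.
by apply: ler_wpM2l; rewrite ?subr_ge0 ?ler_nat ?k_le ?s_le.
Qed.

(** One strict bound, at the last index, suffices because the last increment of [k] is positive. *)
Lemma norm_abel_lt (F : numDomainType) (k : nat -> nat) (s : nat -> F) n B :
  (0 < n)%N -> (forall i, (i < n)%N -> (k i < k i.+1)%N) ->
  (forall i, (i < n)%N -> `|s i.+1| <= B) -> `|s n| < B ->
  `|\sum_(i < n) ((k i.+1)%:R - (k i)%:R) * s i.+1|
    < ((k n)%:R - (k 0%N)%:R) * B.
Proof.
case: n => // n _ k_lt s_le s_lt.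
have -> : (k n.+1)%:R - (k 0%N)%:R =
    ((k n)%:R - (k 0%N)%:R) + ((k n.+1)%:R - (k n)%:R) :> F by ring.
rewrite [ltRHS]mulrDl big_ord_recr /=.
apply: le_lt_trans (ler_normD _ _) _; apply: ler_ltD.
  by apply: norm_abel_le => i /ltnW; [move/k_lt/ltnW | exact: s_le].
by rewrite normrM ger0_norm ?ltr_pM2l ?subr_gt0 ?subr_ge0 ?ltr_nat ?ler_nat
           ?k_lt // ltnW ?k_lt.
Qed.

(** * Passage to the limit in the Schwarz lemma *)

Lemma le_geometric_limit (R : archiRealFieldType) (x r : R) M :
  0 <= r < 1 -> (forall L, (M <= L)%N -> x <= r + 2 * r ^+ L) -> x <= r.
Proof.
move=> /andP[r_ge0 r_lt1] x_le; rewrite leNgt; apply/negP => r_lt_x.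
have geom L : L%:R * r ^+ L * (1 - r) <= 1.
  have le_sum : L%:R * r ^+ L <= \sum_(i < L) r ^+ i.
    rewrite mulr_natl -[X in _ *+ X]card_ord -sumr_const; apply: ler_sum => i _.
    by rewrite ler_wiXn2l ?(ltW r_lt1) ?(ltnW (ltn_ord i)).
  apply: (@le_trans _ _ ((\sum_(i < L) r ^+ i) * (1 - r))).
    by rewrite ler_wpM2r // subr_ge0 ltW.
  by rewrite mulrC -opprB mulNr -subrX1 opprB gerBl exprn_ge0.
have e_gt0 : 0 < (x - r) * (1 - r) by rewrite mulr_gt0 ?subr_gt0.
(* By [geom], 2 r^L <= 2 / (L (1 - r)), which is below x - r once L > y. *)
pose y := 2 / ((x - r) * (1 - r)); pose L := (M + Num.bound y)%N.
have y_lt : y < L%:R.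
  apply: lt_le_trans (archi_boundP _) _; first by rewrite divr_ge0 // ltW.
  by rewrite ler_nat leq_addl.
have := x_le L (leq_addr _ _); apply/negP; rewrite -ltNge -ltrBrDl.
have L_gt0 : 0 < L%:R :> R by rewrite (le_lt_trans _ y_lt) // divr_ge0 // ltW.
have r1_gt0 : 0 < 1 - r by rewrite subr_gt0.
rewrite -(ltr_pM2l L_gt0) -(ltr_pM2r r1_gt0).
move: y_lt; rewrite ltr_pdivrMr // => y_lt.
have := geom L; nra.
Qed.

Section LacunaryTails.
Variable R : realType.
Implicit Types (z t : R[i]).

Lemma Re_complex_ge z : 2^-1 <= complex.Re z -> 2^-1 <= 'Re z.
Proof.
have -> : 'Re z = (complex.Re z)%:C%C by rewrite ReJ_add ReE.
by rewrite -(@lecR R) fmorphV rmorph_nat.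
Qed.

(** The Schwarz lemma for (T - 1) / T, which vanishes at 0 and maps the disc into the closed
    disc. *)
Lemma Schwarz_half_plane (T : {poly R[i]}) z : T`_0 = 1 ->
  (forall t, `|t| <= 1 -> 2^-1 <= 'Re T.[t]) ->
  `|z| < 1 -> `|T.[z] - 1| <= `|z| * `|T.[z]|.
Proof.
move=> T0 T_ge z_lt1; apply: norm_sub1_le_scale; first by rewrite normr_ge0.
have := fun L => @Schwarz_disc_approx _ T z L T0 T_ge z_lt1.
move: z_lt1 (normr_ge0 z); set x := `|_ - 1|.
(* Norms are elements of [R[i]]; they are pulled back to the Archimedean field [R] to let L tend to
   infinity. *)
have [r ->] : exists r : R, `|z| = r%:C%C by apply/complex_realP/normr_real.
have [y ->] : exists y : R, x = y%:C%C by apply/complex_realP/normr_real.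
rewrite ltcR lecR => r_lt1 r_ge0 y_le.
rewrite lecR; apply: (@le_geometric_limit _ _ _ (size T)); first by rewrite r_ge0.
move=> L TL; rewrite -lecR rmorphD rmorphM rmorph_nat rmorphXn.
exact: y_le.
Qed.

(** * Tails of the lacunary polynomial *)

Variables (n : nat) (k : nat -> nat) (a : nat -> R[i]).
Hypothesis k_incr :
  forall i j : nat, (i < j)%N -> (j <= n)%N -> (k i < k j)%N.
Hypothesis a_neq0 : forall nu : nat, (nu <= n)%N -> a nu != 0.
Hypothesis tail_Re_ge : forall nu : nat, (nu <= n)%N ->
  forall t, `|t| <= 1 -> 2^-1 <= 'Re (tail_quotient n a k nu t).

Local Notation P := (lacunary_poly n a k).
Definition tail nu z := \sum_(nu <= m < n.+1) a m * z ^+ k m.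

Lemma horner_lacunary z : P.[z] = tail 0 z.
Proof.
rewrite horner_sum /tail; apply: eq_bigr => m _.
by rewrite hornerZ hornerXn.
Qed.

Lemma horner_deriv_lacunary z :
  z * P^`().[z] = \sum_(m < n.+1) (k m)%:R * (a m * z ^+ k m).
Proof.
rewrite raddf_sum horner_sum mulr_sumr big_mkord; apply: eq_bigr => m _.
rewrite /= derivZ derivXn hornerZ hornerMn hornerXn.
case: (k m) => [|j]; first by rewrite mulr0n !mulr0 mul0r.
by rewrite /= exprS -mulr_natl; ring.
Qed.

Lemma tail_recl nu z : (nu <= n)%N ->
  tail nu z = a nu * z ^+ k nu + tail nu.+1 z.
Proof. by move=> nu_n; rewrite /tail big_ltn. Qed.

Lemma tailE nu z : (nu <= n)%N ->
  tail nu z = a nu * z ^+ k nu * tail_quotient n a k nu z.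
Proof.
move=> nu_n; rewrite /tail -{1}[nu]add0n big_addn subSn // mulr_sumr.
apply: eq_big_nat => j /andP[_ j_lt].
have k_le : (k nu <= k (j + nu))%N.
  have [->|j_gt0] := posnP j; first by rewrite add0n.
  by apply/ltnW/k_incr; lia.
rewrite -[in LHS](subnKC k_le) exprD.
by have := a_neq0 nu_n; move=> *; field.
Qed.

Lemma norm_tail_step nu z : (nu < n)%N -> `|z| <= 1 ->
  `|tail nu.+1 z| <= `|tail nu z|.
Proof.
move=> nu_n z1; have -> : tail nu.+1 z =
    a nu * z ^+ k nu * (tail_quotient n a k nu z - 1).
  by rewrite mulrBr mulr1 -tailE 1?ltnW // (@tail_recl nu) 1?ltnW // addrC addKr.
rewrite (@tailE nu) 1?ltnW // [leLHS]normrM [leRHS]normrM ler_wpM2l //.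
by apply/norm_sub1_le/tail_Re_ge => //; exact: ltnW.
Qed.

Lemma norm_tail_le i j z : (i <= j <= n)%N -> `|z| <= 1 ->
  `|tail j z| <= `|tail i z|.
Proof.
move=> /andP[ij jn] z1; rewrite -(subnKC ij) in jn *.
elim: (j - i)%N jn => [|d IH] jn; first by rewrite addn0.
rewrite addnS in jn *; apply: le_trans (IH (ltnW jn)).
exact: norm_tail_step.
Qed.

(** The hypothesis for the last but one index concerns a binomial. *)
Lemma norm_last_coef_le m : n = m.+1 -> `|a n / a m| <= 2^-1.
Proof.
move=> Dn; apply: (@norm_binomial_coef_le _ _ (k n - k m)) => [|t t1].
  by rewrite subn_gt0 k_incr // Dn.
have mn : (m <= n)%N by rewrite Dn.
have := tail_Re_ge mn t1; rewrite /tail_quotient Dn subSnn.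
rewrite big_nat_recr //= big_nat1 add0n add1n subnn expr0 mulr1.
by rewrite divff ?a_neq0.
Qed.

(** This is [norm_binomial_lt] times the leading term of [tail m]. The factor |z| serves the bound
    on P' itself, where z is cancelled. *)
Lemma norm_last_tail_lt m z : n = m.+1 -> 0 < `|z| < 1 ->
  `|tail n z| < `|z| * `|tail m z|.
Proof.
move=> Dn z01; have mn : (m < n)%N by rewrite Dn.
have a_m := a_neq0 (ltnW mn); have k_mn : (k m < k n)%N by rewrite k_incr.
have Etail : tail n z = a m * z ^+ k m * (a n / a m * z ^+ (k n - k m)).
  by rewrite /tail big_nat1 -[in LHS](subnKC (ltnW k_mn)) exprD; field.
have -> : tail m z = a m * z ^+ k m * (1 + a n / a m * z ^+ (k n - k m)).
  by rewrite tail_recl 1?ltnW // -Dn Etail mulrDr mulr1.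
rewrite Etail normrM [X in _ < _ * X]normrM mulrCA ltr_pM2l.
  by apply: norm_binomial_lt; rewrite ?subn_gt0 ?norm_last_coef_le.
case/andP: z01 => z_gt0 _; rewrite normr_gt0 mulf_neq0 //.
by rewrite expf_neq0 // -normr_gt0.
Qed.

(** A zero would give the first tail quotient real part 0 < 1/2. The condition on z^(k_0) covers
    both cases of (i). *)
Lemma lacunary_neq0 z : `|z| <= 1 -> z ^+ k 0%N != 0 -> P.[z] != 0.
Proof.
move=> z1 zk; rewrite horner_lacunary tailE // !mulf_neq0 ?a_neq0 //.
apply: contraTneq (tail_Re_ge (leq0n n) z1) => ->.
by rewrite raddf0 -real_ltNge ?invr_gt0 // ?real0 ?ger0_real ?invr_ge0.
Qed.

(** * Bounds on z P'(z) *)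

Lemma horner_deriv_abel z :
  z * P^`().[z] = (k 0%N)%:R * tail 0 z +
    \sum_(i < n) ((k i.+1)%:R - (k i)%:R) * tail i.+1 z.
Proof.
rewrite horner_deriv_lacunary.
exact: (abel_summation (fun m => (k m)%:R) (fun m => a m * z ^+ k m)).
Qed.

Lemma norm_horner_deriv_le z : `|z| <= 1 ->
  `|z * P^`().[z]| <= (k n)%:R * `|P.[z]|.
Proof.
move=> z1; rewrite horner_deriv_abel horner_lacunary.
apply: le_trans (ler_normD _ _) _.
(* Splitting k_n as k_0 + (k_n - k_0) matches the two parts of the Abel sum. *)
rewrite -[X in _ <= X * _](subrKC (k 0%N)%:R) mulrDl.
rewrite normrM normr_nat lerD2l; apply: (@norm_abel_le _ k (tail^~ z)) => i i_n.
  exact/ltnW/k_incr.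
by apply: norm_tail_le.
Qed.

Lemma norm_horner_deriv_lt z : (0 < n)%N -> 0 < `|z| < 1 ->
  `|z * P^`().[z]| < (k n)%:R * `|P.[z]|.
Proof.
move=> n_gt0 z01; rewrite horner_deriv_abel horner_lacunary.
have /andP[z_gt0 /ltW z1] := z01; have Dn := esym (prednK n_gt0).
apply: le_lt_trans (ler_normD _ _) _.
rewrite -[X in _ < X * _](subrKC (k 0%N)%:R) mulrDl normrM normr_nat ltrD2l.
apply: (@norm_abel_lt _ k (tail^~ z)) => // [i i_n|i i_n|].
- exact: k_incr.
- by apply: norm_tail_le => //; lia.
apply: lt_le_trans (norm_last_tail_lt Dn z01) _.
rewrite -[leRHS]mul1r ler_pM //; apply: norm_tail_le => //; lia.
Qed.

(** * The bound on P' when k_0 = 0 *)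

Section NonzeroConstantTerm.
Hypothesis k0 : k 0%N = 0%N.

(** As k_0 = 0, this is the tail quotient of index 0 in polynomial form, as the Schwarz lemma
    requires. *)
Local Notation T := ((a 0%N)^-1 *: P).

Lemma tail1_0 : tail 1 0 = 0.
Proof.
rewrite /tail big_nat big1 // => m /andP[m_gt0 m_n].
by rewrite expr0n -leqn0 leqNgt (leq_ltn_trans _ (k_incr m_gt0 _)) ?mulr0.
Qed.

Lemma horner_lacunary0 : P.[0] = a 0%N.
Proof. by rewrite horner_lacunary tail_recl // tail1_0 k0 expr0 mulr1 addr0. Qed.

Lemma normalized_coef0 : T`_0 = 1.
Proof. by rewrite coefZ -horner_coef0 horner_lacunary0 mulVf ?a_neq0. Qed.

Lemma normalized_Re_ge t : `|t| <= 1 -> 2^-1 <= 'Re T.[t].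
Proof.
move=> t1; rewrite hornerZ horner_lacunary tailE // k0 expr0 mulr1 mulKf ?a_neq0 //.
exact: tail_Re_ge.
Qed.

Lemma norm_tail1_le z : `|z| < 1 -> `|tail 1 z| <= `|z| * `|tail 0 z|.
Proof.
move=> z_lt1.
have T_le := Schwarz_half_plane normalized_coef0 normalized_Re_ge z_lt1.
have a0 := a_neq0 (leq0n n).
have -> : tail 0 z = a 0%N * T.[z] by rewrite hornerZ mulVKf // horner_lacunary.
have -> : tail 1 z = a 0%N * (T.[z] - 1).
  rewrite mulrBr hornerZ mulVKf // horner_lacunary (@tail_recl 0) // k0.
  by rewrite expr0 mulr1 addrC addKr.
by rewrite [leLHS]normrM [in leRHS]normrM [leRHS]mulrCA ler_pM2l ?normr_gt0.
Qed.

Lemma norm_deriv_lt z : (0 < n)%N -> `|z| < 1 ->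
  `|P^`().[z]| < (k n)%:R * `|P.[z]|.
Proof.
move=> n_gt0 z_lt1; have Dn := esym (prednK n_gt0).
have k_n : (0 < k n)%N by rewrite -k0 k_incr.
have [->|z_neq0] := eqVneq z 0; last first.
  have z_gt0 : 0 < `|z| by rewrite normr_gt0.
  have z1 := ltW z_lt1.
  rewrite -(ltr_pM2l z_gt0) -normrM horner_deriv_abel horner_lacunary.
  have k0C : (k 0%N)%:R = 0 :> R[i] by rewrite k0.
  rewrite k0C mul0r add0r mulrCA -[(k n)%:R]subr0 -[X in _ - X]k0C.
  apply: (@norm_abel_lt _ k (tail^~ z)) => // [i i_n|i i_n|].
  - exact: k_incr.
  - apply: le_trans (norm_tail1_le z_lt1); apply: norm_tail_le => //; lia.
  apply: lt_le_trans (norm_last_tail_lt Dn _) _; first by rewrite z_gt0.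
  by rewrite ler_pM2l //; apply: norm_tail_le => //; lia.
rewrite horner_lacunary0 horner_coef0 coef_deriv mulr1n.
have a0 := a_neq0 (leq0n n).
have -> : P`_1 = a 0%N * T`_1 by rewrite coefZ mulVKf.
rewrite normrM mulrC ltr_pM2r ?normr_gt0 //.
(* The bound |T_1| <= 1 is strict enough if k_n > 1; if k_n = 1, P is a binomial and the last
   coefficient bound gives 1/2. *)
have [k_n1|k_n1] := ltnP 1 (k n).
  apply: le_lt_trans (norm_coef1_le normalized_coef0 normalized_Re_ge) _.
  by rewrite ltr1n.
have n1 : n = 1%N.
  apply/eqP; rewrite eqn_leq n_gt0 andbT leqNgt; apply/negP => n_gt1.
  by have := k_incr n_gt1 (leqnn n); have := k_incr (ltnSn 0) n_gt0; lia.
have Ek1 : k n = 1%N by apply/eqP; rewrite eqn_leq k_n1.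
rewrite Ek1; apply: le_lt_trans (_ : 2^-1 < 1); last first.
  by rewrite invf_lt1 ?ltr1n.
have -> : T`_1 = a n / a 0%N.
  rewrite coefZ /lacunary_poly n1 big_nat_recr //= big_nat1 coefD !coefZ !coefXn.
  have k1 : k 1%N = 1%N by rewrite -[X in k X]n1.
  by rewrite k0 k1 /= mulr0 mulr1 add0r mulrC.
exact: norm_last_coef_le.
Qed.

End NonzeroConstantTerm.
End LacunaryTails.

(** * The three assertions and the equality cases *)

Theorem theorem1p1 (R : realType) (n : nat) (k : nat -> nat) (a : nat -> R[i])
    (P : {poly R[i]})
    (k_incr : forall i j : nat, (i < j)%N -> (j <= n)%N -> (k i < k j)%N)
    (a_neq0 : forall nu : nat, (nu <= n)%N -> a nu != 0)
    (P_def : P = lacunary_poly n a k)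
    (min_ge : forall nu : nat, (nu <= n)%N ->
       forall t : R[i], `|t| <= 1 ->
         2^-1 <= complex.Re (tail_quotient n a k nu t)) :
  [/\ (* (i) *)
      (k 0%N = 0%N -> forall z : R[i], `|z| <= 1 -> ~~ root P z) /\
      ((0 < k 0%N)%N ->
         forall z : R[i], `|z| <= 1 -> z != 0 -> ~~ root P z),
      (* (ii) *)
      (forall z : R[i], `|z| <= 1 ->
         `|z * P^`().[z]| <= (k n)%:R * `|P.[z]|) /\
      (forall z : R[i], `|z| < 1 ->
         (`|z * P^`().[z]| = (k n)%:R * `|P.[z]| <->
          [\/ [/\ n = 0%N, (0 < k 0%N)%N & P = a 0%N *: 'X^(k 0%N)],
              (* degenerate equalities 0 = 0 *)
              n = 0%N /\ k 0%N = 0%N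
            | z = 0 /\ (0 < k 0%N)%N]))
    & (* (iii) *)
      k 0%N = 0%N -> (1 <= n)%N ->
        forall z : R[i], `|z| < 1 ->
          `|P^`().[z]| < (k n)%:R * `|P.[z]|].
Proof.
have tail_Re_ge nu : (nu <= n)%N -> forall t, `|t| <= 1 ->
    2^-1 <= 'Re (tail_quotient n a k nu t).
  by move=> nu_n t t1; apply/Re_complex_ge/min_ge.
rewrite {}P_def; split.
- split=> [k0|_] z z1 => [|z0]; rewrite /root; apply: lacunary_neq0 => //.
    by rewrite k0 expr0 oner_neq0.
  exact: expf_neq0.
- split=> [z z1|z z1]; first exact: norm_horner_deriv_le.
  have lac0 : n = 0%N -> lacunary_poly n a k = a 0%N *: 'X^(k 0%N).
    by move=> ->; rewrite /lacunary_poly big_nat1.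
  split=> [E|[[n0 _ _]|[n0 k0]|[-> k0]]].
  + have [n0|n_gt0] := posnP n.
      have [k0|k_gt0] := posnP (k 0%N); first by constructor 2.
      by constructor 1; rewrite lac0.
    have [z0|z_neq0] := eqVneq z 0; last first.
      have := @norm_horner_deriv_lt _ _ _ _ k_incr a_neq0 tail_Re_ge z n_gt0.
      by rewrite normr_gt0 z_neq0 z1 E ltxx => /(_ isT).
    (* At z = 0 equality forces k_n P(0) = 0, whereas k_0 = 0 would give P(0) = a_0 != 0 and k_n >
       0. *)
    constructor 3; split=> //; have [k0|//] := posnP (k 0%N).
    move/esym/eqP: E; rewrite z0 mul0r normr0 mulf_eq0 normr_eq0 pnatr_eq0.
    rewrite (horner_lacunary0 a k_incr k0) (negPf (a_neq0 _ _)) // orbF.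
    by rewrite -leqn0 leqNgt (leq_ltn_trans _ (k_incr _ _ n_gt0 _)).
  + rewrite horner_deriv_lacunary horner_lacunary /tail n0 big_ord1 big_nat1.
    by rewrite normrM normr_nat.
  + rewrite horner_deriv_lacunary n0 big_ord1 k0 !mul0r normr0 //.
  + rewrite mul0r normr0 horner_lacunary /tail big_nat.
    rewrite big1 ?normr0 ?mulr0 // => m /andP[_ m_n].
    have km : (0 < k m)%N.
      have [->//|m_gt0] := posnP m.
      by apply: leq_ltn_trans (k_incr _ _ m_gt0 m_n).
    by rewrite expr0n gtn_eqF // mulr0.
- by move=> k0 n_gt0 z z1; apply: norm_deriv_lt.
Qed.
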